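(* If $G$ is a connected graph of order $n \geq 3$ with exactly $p \geq 1$ vertices of degree 1, then $d(G) \geq p$.
   Context: Graphs are finite and simple; the order of a graph is its number of vertices. The deduction game on a graph $G$: a layout is a placement of searchers on vertices of $G$ (a vertex may receive several searchers). A vertex is occupied in the layout if it contains at least one searcher, and unoccupied otherwise. A vertex is protected if it is occupied in the initial layout or if a searcher has moved there at some point, and unprotected otherwise. A vertex is fireable if the number of searchers on it is greater than or equal to the number of its unprotected neighbours. Initially every searcher is mobile; once a searcher has moved once, it becomes immobile (cannot move again). At each stage, simultaneously, for every fireable vertex $v$ containing mobile searchers, one searcher moves from $v$ to each unprotected neighbour of $v$ (excess searchers stay on $v$; several fireable vertices may send a searcher to the same target). Stages continue until no new searchers move. The layout is successful if at the end all vertices of $G$ are protected. The deduction number $d(G)$ is the minimum number of searchers in a successful layout on $G$. *)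

(* Defs.v *)
From mathcomp Require Import all_boot.
From mathcomp Require Import boolp.

Set Implicit Arguments.
Unset Strict Implicit.
Unset Printing Implicit Defensive.

Section Graph.

Variables (T : finType) (e : rel T).

Definition simple_graph : Prop := symmetric e /\ irreflexive e.

Definition connected_graph : Prop := forall x y : T, connect e x y.

Definition neighbours (v : T) : {set T} := [set w | e v w].

Definition degree (v : T) : nat := #|neighbours v|.

Definition degree1_vertices : {set T} := [set v | degree v == 1].

End Graph.

Section DeductionGame.

Variables (T : finType) (e : rel T).

(* Number of searchers placed on each vertex. *)
Definition layout := {ffun T -> nat}.

Definition occupied (L : layout) (v : T) : bool := 0 < L v.

Definition nb_searchers (L : layout) : nat := \sum_(v : T) L v.

(* Searchers on the same vertex are interchangeable up to their mobility, so a
   position of the game only counts mobile and immobile searchers. *)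
Record state := State {
  mobile : {ffun T -> nat};
  immobile : {ffun T -> nat};
  protected : {set T}
}.

Definition init (L : layout) : state :=
  State L [ffun=> 0] [set v | occupied L v].

Definition unprotected_neighbours (s : state) (v : T) : {set T} :=
  neighbours e v :\: protected s.

Definition fireable (s : state) (v : T) : bool :=
  #|unprotected_neighbours s v| <= mobile s v + immobile s v.

Definition fires (s : state) (v : T) : bool :=
  fireable s v && (0 < mobile s v).

(* During the next stage one searcher moves from v to w. *)
Definition moves (s : state) (v w : T) : bool :=
  fires s v && (w \in unprotected_neighbours s v).

(* In positions reachable from [init L] no vertex holds both mobile and immobile
   searchers (a searcher only moves to a vertex not occupied in L), so a firing
   vertex has enough mobile searchers and the subtraction is never truncated. *)
Definition step (s : state) : state :=
  State [ffun v => mobile s v - #|[set w | moves s v w]|]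
        [ffun w => immobile s w + #|[set v | moves s v w]|]
        (protected s :|: [set w | [exists v, moves s v w]]).

Definition stage (L : layout) (t : nat) : state := iter t step (init L).

Definition finished (s : state) : Prop := forall v w : T, ~~ moves s v w.

Definition successful (L : layout) : Prop :=
  exists t : nat,
    finished (stage L t) /\ forall v : T, v \in protected (stage L t).

Definition success_with (k : nat) : bool :=
  `[< exists L : layout, successful L /\ nb_searchers L = k >].

Lemma success_with_ex : exists k, success_with k.
Proof.
exists (nb_searchers [ffun=> 1]); apply/asboolP.
exists [ffun=> 1]; split=> //; exists 0; split=> [v w|v].
  by rewrite /moves !inE /occupied ffunE andbF.
by rewrite inE /occupied ffunE.
Qed.

Definition deduction_number : nat := ex_minn success_with_ex.

End DeductionGame.

(* Main.v *)
Require Import Defs.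
From mathcomp Require Import all_boot.

(** The searchers can be charged to the leaves locally.  An unoccupied leaf can
    only be protected by a searcher coming from its neighbour [v].  The first
    time [v] sends a searcher to a leaf, all leaves at [v] that were not
    occupied in the layout are still unprotected, because only [v] can reach
    them; so [v] can fire only if it holds at least as many searchers as there
    are such leaves.  A firing vertex holds a mobile searcher, hence is occupied
    in the layout; it has then been protected from the start, has never received
    a searcher, and holds only searchers of its own.  Therefore the layout
    itself puts on [v] at least one searcher per unoccupied leaf at [v]
    ([card_vacant_leaves]).

    In a connected graph of order at least 3 no two leaves are adjacent
    ([neighbour_of_leaf_not_leaf]), so the searchers charged in this way stand
    on vertices of degree other than 1.  They are disjoint from those that stand
    on the occupied leaves, and the total is at least the number of leaves. *)

Section Graph.

Variables (T : finType) (e : rel T).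

Lemma leaf_neighbour_unique {l u v : T} :
  l \in degree1_vertices e -> e l u -> e l v -> u = v.
Proof.
rewrite inE => /cards1P[w Nl] lu lv.
have: u \in neighbours e l by rewrite inE.
have: v \in neighbours e l by rewrite inE.
by rewrite Nl !inE => /eqP-> /eqP->.
Qed.

Lemma leaf_neighbour_exists {l : T} :
  l \in degree1_vertices e -> exists v, e l v.
Proof.
rewrite inE => /cards1P[w Nl]; exists w.
by have := set11 w; rewrite -Nl inE.
Qed.

(** Two adjacent leaves form a connected component by themselves. *)
Lemma neighbour_of_leaf_not_leaf {l v : T} :
  symmetric e -> connected_graph e -> 2 < #|T| ->
  l \in degree1_vertices e -> e l v -> v \notin degree1_vertices e.
Proof.
move=> sym_e conn_e T_gt2 leaf_l lv; apply/negP => leaf_v.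
have vl : e v l by rewrite sym_e.
have closed_lv : closed e [set l; v].
  apply: intro_closed => [|x y xy].
    exact: sym_connect_sym.
  rewrite !inE => /orP[]/eqP eq_x; rewrite {}eq_x in xy.
    by rewrite (leaf_neighbour_unique leaf_l xy lv) eqxx orbT.
  by rewrite (leaf_neighbour_unique leaf_v xy vl) eqxx.
have lvT x : x \in [set l; v].
  by rewrite -(closed_connect closed_lv (conn_e l x)) !inE eqxx.
have : #|T| <= #|[set l; v]| by rewrite -cardsT subset_leq_card //; apply/subsetP.
by rewrite leqNgt (leq_ltn_trans _ T_gt2) // cards2; case: (l != v).
Qed.

End Graph.

Section DeductionGame.

Variables (T : finType) (e : rel T) (L : layout T).

Lemma mobile_stage_le t v : mobile (stage e L t) v <= L v.
Proof.
elim: t => [|t IHt] //=; rewrite ffunE.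
exact: leq_trans (leq_subr _ _) IHt.
Qed.

Lemma protected_stage_occupied {t v} :
  occupied L v -> v \in protected (stage e L t).
Proof.
by move=> Lv; elim: t => [|t IHt]; rewrite /= inE // IHt.
Qed.

(** Searchers only move to unprotected vertices. *)
Lemma immobile_stage_occupied {t v} :
  occupied L v -> immobile (stage e L t) v = 0.
Proof.
move=> Lv; elim: t => [|t IHt] /=; rewrite ffunE // IHt add0n.
apply: eq_card0 => u; rewrite inE /moves inE.
by rewrite protected_stage_occupied ?andbF.
Qed.

Lemma card_unprotected_neighbours_fires {t v} :
  fires e (stage e L t) v ->
  #|unprotected_neighbours e (stage e L t) v| <= L v.
Proof.
case/andP=> fireable_v mob_gt0.
have Lv : occupied L v := leq_trans mob_gt0 (mobile_stage_le t v).
apply: leq_trans fireable_v _.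
by rewrite immobile_stage_occupied // addn0 mobile_stage_le.
Qed.

Definition vacant_leaves (v : T) : {set T} :=
  [set l in degree1_vertices e | ~~ occupied L l & e l v].

Hypothesis sym_e : symmetric e.

(** Up to the first move from [v] to one of them, all vacant leaves at [v] are
    unprotected, so that this move needs a searcher for each of them. *)
Lemma vacant_leaves_stage t v :
  [disjoint vacant_leaves v & protected (stage e L t)]
  \/ #|vacant_leaves v| <= L v.
Proof.
elim: t => [|t [unprot_t|]]; [left | | by right].
  apply/pred0P => l; rewrite /= !inE.
  by case: (occupied L l); rewrite ?andbF.
have [disj|] := boolP [disjoint vacant_leaves v & protected (stage e L t.+1)].
  by left.
case/pred0Pn=> l /andP[/= vac_l]; rewrite inE (disjointFr unprot_t vac_l) /=.
rewrite inE => /existsP[u /andP[fires_u]].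
move: (vac_l); rewrite !inE => /and3P[leaf_l _ lv] /andP[_ ul].
have eq_uv : u = v.
  apply: (leaf_neighbour_unique _ e (l := l)); rewrite ?inE //.
  by rewrite sym_e.
right; rewrite {}eq_uv in fires_u.
apply: leq_trans (card_unprotected_neighbours_fires fires_u).
apply/subset_leq_card/subsetP => m vac_m.
rewrite inE (disjointFr unprot_t vac_m) inE sym_e.
by move: vac_m; rewrite !inE => /and3P[].
Qed.

Lemma card_vacant_leaves v : successful e L -> #|vacant_leaves v| <= L v.
Proof.
case=> t [_ all_prot]; case: (vacant_leaves_stage t v) => // unprot.
rewrite (eq_card0 _) // => l.
by apply/negP => /(disjointFr unprot); rewrite all_prot.
Qed.

Hypothesis conn_e : connected_graph e.
Hypothesis T_gt2 : 2 < #|T|.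

Lemma card_leaves_le_searchers :
  successful e L -> #|degree1_vertices e| <= nb_searchers L.
Proof.
move=> succ_L; set D := degree1_vertices e.
pose O := [set l | occupied L l].
rewrite /nb_searchers (bigID (mem D)) /= -(cardsID O D) leq_add //.
  rewrite [leqRHS](big_setID O) /= -sum1_card.
  apply: leq_trans (leq_addr _ _).
  by apply: leq_sum => l; rewrite !inE => /andP[].
have cover : D :\: O \subset \bigcup_(v | v \notin D) vacant_leaves v.
  apply/subsetP => l /setDP[leaf_l vac_l].
  have [v lv] := leaf_neighbour_exists _ _ leaf_l.
  apply/bigcupP; exists v.
    exact: neighbour_of_leaf_not_leaf _ _ _ leaf_l lv.
  by rewrite inE in vac_l; rewrite inE leaf_l vac_l lv.
apply: leq_trans (subset_leq_card cover) _.
elim/big_rec2: _ => [|v m A _ leAm]; first by rewrite cards0.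
apply: leq_trans (leq_card_setU _ _) _.
by rewrite leq_add // card_vacant_leaves.
Qed.

End DeductionGame.

Theorem theorem3p3 (T : finType) (e : rel T) (n p : nat)
    (simple_e : simple_graph e) (connected_e : connected_graph e)
    (order_e : #|T| = n) (n_ge3 : 3 <= n)
    (leaves_e : #|degree1_vertices e| = p) (p_ge1 : 1 <= p) :
  p <= deduction_number e.
Proof.
have [sym_e _] := simple_e.
rewrite /deduction_number; case: ex_minnP => k /boolp.asboolP[L [succ_L <-]] _.
by rewrite -leaves_e card_leaves_le_searchers // order_e.
Qed.
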